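(* Let $G$ be a hyperbolic group, let $H_1,H_2,\dots,H_s$ be quasiconvex subgroups of $G$, and let $K$ be an arbitrary subgroup of $G$. Then the following two conditions are equivalent: (a) $|K:(K\cap H_j^g)|=\infty$ for every $j\in\{1,2,\dots,s\}$ and every $g\in G$; (b) there exists an element $x\in K$ of infinite order such that $\langle x\rangle\cap(H_1^G\cup H_2^G\cup\dots\cup H_s^G)=\{1_G\}$.
   Context: A finitely generated group $G$ is hyperbolic if its Cayley graph $\Gamma(G,\mathcal{A})$ with respect to some (equivalently, any) finite symmetrized generating set $\mathcal{A}=\mathcal{A}^{-1}$ is a Gromov hyperbolic metric space. A subset $Q\subseteq G$ is $\varepsilon$-quasiconvex ($\varepsilon\ge 0$) if every geodesic in $\Gamma(G,\mathcal{A})$ connecting two elements of $Q$ lies in the closed $\varepsilon$-neighborhood of $Q$; $Q$ is quasiconvex if it is $\varepsilon$-quasiconvex for some $\varepsilon$ (for hyperbolic $G$ this does not depend on the choice of the finite generating set). For $g\in G$ and a subgroup $H\le G$, $H^g=gHg^{-1}$, and $H^G=\{ghg^{-1}\mid h\in H, g\in G\}$. *)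

(* Defs.v *)
From HB Require Import structures.
From mathcomp Require Import all_boot all_order all_algebra.
From mathcomp Require Import all_classical all_reals numfun.

Set Implicit Arguments.
Unset Strict Implicit.
Unset Printing Implicit Defensive.

Import Order.TTheory GRing.Theory Num.Theory.

Local Open Scope classical_set_scope.
Local Open Scope ring_scope.

(* Groups are arbitrary (possibly infinite) [groupType]s; subsets of a group
   are classical sets. *)
Section Groups.
Variable G : groupType.
Local Open Scope group_scope.
Implicit Types (x g : G) (A H K L : set G).

Definition subgroup H : Prop := group_closed (mem H).

Definition generated A : set G := smallest subgroup A.

Definition infinite_order x : Prop := forall n : nat, (0 < n)%N -> x ^+ n <> 1.

(* H^g = g H g^-1; beware that the library's [h ^ g] is g^-1 h g. *)
Definition conj_set H g : set G := [set g * h * g^-1 | h in H].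

Definition conj_closure H : set G := [set g * h * g^-1 | h in H & g in setT].

Definition left_cosets K L : set (set G) :=
  [set [set x * y | y in L] | x in K].

(* |K : L| = oo, for a subgroup L of K. *)
Definition infinite_index K L : Prop := infinite_set (left_cosets K L).

Definition finite_sym_generating A : Prop :=
  [/\ finite_set A, (forall a, A a -> A a^-1) & generated A = setT].

Definition adjacent A (u v : G) : Prop := A (u^-1 * v).

Fixpoint walk A (n : nat) (u v : G) : Prop :=
  if n is m.+1 then exists2 w, adjacent A u w & walk A m w v else u = v.

End Groups.

Section Metric.
Variables (R : realType) (T : Type).
Implicit Types (X : set T) (d : T -> T -> R).

Definition gromov_product d (w x y : T) : R := (d w x + d w y - d x y) / 2.

Definition gromov_hyperbolic X d : Prop :=
  exists2 delta : R, 0 <= delta &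
    forall w x y z, X w -> X x -> X y -> X z ->
      Num.min (gromov_product d w x y) (gromov_product d w y z) - delta
        <= gromov_product d w x z.

Definition geodesic X d (l : R) (c : R -> T) : Prop :=
  (forall s, 0 <= s <= l -> X (c s)) /\
  (forall s t, 0 <= s <= l -> 0 <= t <= l -> d (c s) (c t) = `|s - t|).

End Metric.

(* The Cayley graph as a geodesic metric space: its geometric realization with
   edges of length 1.  A point is given by its barycentric coordinates, i.e.
   it is a function G -> R.  Edges are undirected: u and v are joined by one
   edge when u^-1 v is in A, and loops (which arise if 1 is in A) are
   discarded. *)
Section CayleyGraph.
Variables (R : realType) (G : groupType).
Implicit Types (A Q : set G) (x y : G -> R).

Definition vertex (u : G) : G -> R := \1_[set u].

Definition edge_point (u v : G) (t : R) : G -> R :=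
  fun w => (1 - t) * vertex u w + t * vertex v w.

Definition cayley A : set (G -> R) :=
  [set x | (exists u, x = vertex u) \/
           (exists u v t, [/\ adjacent A u v, 0 <= t <= 1 &
                              x = edge_point u v t])].

(* The length metric: the infimum of the lengths of the routes from x to y.
   A route either stays inside one edge, or leaves x through an endpoint u of
   an edge carrying x, walks along n edges to an endpoint v of an edge carrying
   y, and then goes to y.  The part of the edge between x and u has
   length 1 - x u. *)
Definition cayley_dist A x y : R :=
  inf ([set r | exists u v s t,
          [/\ adjacent A u v, x = edge_point u v s, y = edge_point u v t &
              r = `|s - t|]] `|`
       [set r | exists u v n,
          [/\ 0 < x u, 0 < y v, walk A n u v &
              r = (1 - x u) + n%:R + (1 - y v)]]).

Definition hyperbolic_group : Prop :=
  exists2 A : set G, finite_sym_generating A &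
    gromov_hyperbolic (cayley A) (cayley_dist A).

Definition eps_quasiconvex A (eps : R) Q : Prop :=
  forall (g h : G) (l : R) (c : R -> G -> R),
    Q g -> Q h -> 0 <= l -> geodesic (cayley A) (cayley_dist A) l c ->
    c 0 = vertex g -> c l = vertex h ->
    forall t, 0 <= t <= l ->
      exists2 q, Q q & cayley_dist A (c t) (vertex q) <= eps.

(* In a hyperbolic group this does not depend on the choice of A. *)
Definition quasiconvex Q : Prop :=
  exists2 A : set G, finite_sym_generating A &
    exists2 eps : R, 0 <= eps & eps_quasiconvex A eps Q.

End CayleyGraph.

Arguments hyperbolic_group : clear implicits.
Arguments quasiconvex R {G} Q.

(* Main.v *)
(* Let [x] in [K] have a nontrivial power in [g H g^-1], and suppose that the
   orbit of [x] is a quasigeodesic with constants depending on [K]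
   only.  Quasiconvexity keeps this orbit within a uniform distance [r] of
   [g H], whence [x] lies in [B_r H B_r].  By B. H. Neumann's lemma (a) prevents
   [K] from being covered by the finitely many double translates [a H_j b] with
   [a], [b] in a ball, so it suffices to turn an arbitrary [k] of [K] into such
   an [x] by a bounded modification.
   If [K] fixes no point of the boundary, then for some finite set [F] and every
   [k] in [K] some [f] in [F] moves [k] away from the direction of [k], hence
   one of [k], [f k] has bounded Gromov product with the inverse of [k], and
   this is the required quasigeodesicity.
   If [K] fixes a boundary point, its Busemann function is a quasimorphism on
   [K] taking bounded values on finite subsets only; then [K] contains an
   element of infinite order, and any subgroup containing such an element has
   finite index in [K]. *)

Require Import Defs.
From mathcomp Require Import all_boot all_order all_algebra.
From mathcomp Require Import all_classical all_reals numfun.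
From mathcomp Require Import zify lra ring.

Set Implicit Arguments.
Unset Strict Implicit.
Unset Printing Implicit Defensive.

Local Open Scope classical_set_scope.

(** * Subgroups and cosets *)

Section Subgroups.
Variable G : groupType.
Local Open Scope group_scope.
Implicit Types (x y g k : G) (H K L : set G).

Lemma subgroupP H :
  subgroup H <-> H 1 /\ (forall x y, H x -> H y -> H (x * y^-1)).
Proof.
split=> [[H1 HF]|[H1 HF]]; split.
- by move: H1; rewrite inE.
- by move=> x y Hx Hy; have := HF x y; rewrite !inE; apply.
- by rewrite inE.
- by move=> x y; rewrite !inE; apply: HF.
Qed.

Lemma subgroup1 H : subgroup H -> H 1.
Proof. by case/subgroupP. Qed.

Lemma subgroupV H x : subgroup H -> H x -> H x^-1.
Proof. by case/subgroupP=> H1 HF Hx; rewrite -[x^-1]mul1g; apply: HF. Qed.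

Lemma subgroupM H x y : subgroup H -> H x -> H y -> H (x * y).
Proof.
move=> sH Hx Hy; rewrite -[y]invgK; case/subgroupP: (sH) => _; apply=> //.
exact: subgroupV.
Qed.

Lemma subgroupX H x n : subgroup H -> H x -> H (x ^+ n).
Proof.
move=> sH Hx; elim: n => [|n IHn]; first exact: subgroup1.
by rewrite expgS; apply: subgroupM.
Qed.

Lemma subgroupI H K : subgroup H -> subgroup K -> subgroup (H `&` K).
Proof.
move=> /subgroupP[H1 HF] /subgroupP[K1 KF]; apply/subgroupP; split=> //.
by move=> x y [Hx Kx] [Hy Ky]; split; [apply: HF | apply: KF].
Qed.

Lemma conj_setE H g x : conj_set H g x <-> H (g^-1 * x * g).
Proof.
split=> [[h Hh <-]|Hx]; first by rewrite !mulgA mulVg mul1g mulgVK.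
by exists (g^-1 * x * g) => //; rewrite !mulgA mulgV mul1g mulgK.
Qed.

Lemma subgroup_conj H g : subgroup H -> subgroup (conj_set H g).
Proof.
move=> sH; apply/subgroupP; split=> [|x y].
  by apply/conj_setE; rewrite mulg1 mulVg; apply: subgroup1.
move=> /conj_setE Hx /conj_setE Hy; apply/conj_setE.
have -> : g^-1 * (x * y^-1) * g = (g^-1 * x * g) * (g^-1 * y * g)^-1.
  by rewrite !invgM invgK !mulgA mulgK.
by apply: subgroupM => //; apply: subgroupV.
Qed.

Lemma left_coset_eq L x y : subgroup L -> L (x^-1 * y) ->
  [set x * z | z in L] = [set y * z | z in L].
Proof.
move=> sL Lxy; rewrite eqEsubset; split=> _ [z Lz <-].
  exists ((x^-1 * y)^-1 * z); first by apply: subgroupM => //; apply: subgroupV.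
  by rewrite invgM invgK !mulgA mulgV mul1g.
exists ((x^-1 * y) * z); first exact: subgroupM.
by rewrite !mulgA mulgV mul1g.
Qed.

Lemma left_coset_inj L x y : subgroup L ->
  [set x * z | z in L] = [set y * z | z in L] -> L (x^-1 * y).
Proof.
move=> sL eqxy; have [z Lz <-] : [set x * z | z in L] y.
  by rewrite eqxy; exists 1; [apply: subgroup1 | rewrite mulg1].
by rewrite mulKg.
Qed.

Lemma mem_generated1 x n : generated [set x] (x ^+ n).
Proof. by move=> H [sH xH]; apply: subgroupX => //; apply: xH. Qed.

Lemma generated1P x y :
  generated [set x] y -> exists n, y = x ^+ n \/ y = x ^- n.
Proof.
pose P := [set y | exists n, y = x ^+ n \/ y = x ^- n].
move=> /(_ P); apply; split; last by move=> _ ->; exists 1%N; left.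
have PF n m : P (x ^+ n * x ^- m).
  have [lemn|/ltnW lenm] := leqP m n; first by exists (n - m)%N; left; rewrite expgnFr.
  by exists (m - n)%N; right; rewrite expgnFr // invgF.
apply/subgroupP; split=> [|_ _ [n [->|->]] [m [->|->]]]; first by exists 0%N; left.
- exact: PF.
- by rewrite invgK; exists (n + m)%N; left; rewrite expgnDr.
- by exists (m + n)%N; right; rewrite expgnDr invgM.
- rewrite invgK; suff -> : x ^- n * x ^+ m = x ^+ m * x ^- n by exact: PF.
  by apply/esym/commuteV/commuteX2/commute_refl.
Qed.

(** Centres of a covering need not lie in [K]; one whose coset meets [K] is replaced here by a
    representative in [K]. The default 1 of [xget] is never taken. *)
Lemma coset_rep K L a x : subgroup L -> subgroup K -> K x -> L (a^-1 * x) ->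
  let k := xget 1 [set k | K k /\ L (a^-1 * k)] in K k /\ L (k^-1 * x).
Proof.
move=> sL sK Kx Lx k.
have [Kk Lk] : K k /\ L (a^-1 * k).
  by apply: (@xgetPex _ 1 [set k | K k /\ L (a^-1 * k)]); exists x.
split=> //; have -> : k^-1 * x = (a^-1 * k)^-1 * (a^-1 * x).
  by rewrite invgM invgK !mulgA mulgK.
by apply: subgroupM => //; apply: subgroupV.
Qed.

(* B. H. Neumann's lemma: an infinite-index [L i] misses some coset [c (L i)]
   entirely, and translating the covering of [c (L i)] by the other subgroups
   eliminates [L i] from the covering. *)
Lemma neumann_cover (I : eqType) (L : I -> set G) K (r : seq I) (T : seq G) :
  subgroup K -> (forall i, subgroup (L i)) ->
  (forall k, K k -> exists2 a, a \in T & exists2 i, i \in r & L i (a^-1 * k)) ->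
  exists2 i, i \in r & finite_set (left_cosets K (K `&` L i)).
Proof.
move=> sK sL; elim: r T => [|i r IHr] T cov.
  by have [a _ [i]] := cov 1 (subgroup1 sK).
have [finKi|infKi] := pselect (finite_set (left_cosets K (K `&` L i))).
  by exists i; rewrite ?mem_head.
pose rep a := xget 1 [set k | K k /\ L i (a^-1 * k)].
have [c Kc cT] : exists2 c, K c & forall a, a \in T -> ~ L i (a^-1 * c).
  apply: contrapT => ncov; apply: infKi.
  apply: (@sub_finite_set _ _ ((fun a => [set rep a * z | z in K `&` L i]) @` [set` T])).
    move=> _ [x Kx <-].
    have [a aT La] : exists2 a, a \in T & L i (a^-1 * x).
      apply: contrapT => nx; apply: ncov; exists x => // a aT La.
      by apply: nx; exists a.
    have [Ka La'] := coset_rep (sL i) sK Kx La.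
    exists a => //; apply: left_coset_eq; first exact: subgroupI.
    by split=> //; apply: subgroupM => //; apply: subgroupV.
  exact/finite_image/finite_seq.
(* A point of [rep a * L i] is carried into [c * L i], which only the remaining subgroups cover;
   carrying back produces the new centres. *)
have [|j jr finj] := IHr (T ++ [seq rep a * c^-1 * b | a <- T, b <- T]); last first.
  by exists j; rewrite // inE jr orbT.
move=> k Kk; have [a aT [j]] := cov k Kk.
rewrite inE => /predU1P[->{j} Lk|jr Lk]; last first.
  by exists a; [rewrite mem_cat aT | exists j].
have [Ka La] := coset_rep (sL i) sK Kk Lk; rewrite -/(rep a) in Ka La.
set l := (rep a)^-1 * k in La.
have Kcl : K (c * l).
  by apply: subgroupM => //; apply: subgroupM => //; apply: subgroupV.
have [b bT [j]] := cov _ Kcl.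
rewrite inE => /predU1P[->{j} Lb|jr Lb].
  case: (cT b bT); rewrite -[_ * c](mulgK l) -(mulgA b^-1).
  by apply: subgroupM => //; apply: subgroupV => //; case: La.
exists (rep a * c^-1 * b).
  by rewrite mem_cat; apply/orP; right; apply/allpairsP; exists (a, b).
exists j => //.
by move: Lb; rewrite /l !invgM !invgK !mulgA.
Qed.

(** Pigeonhole: two powers of [x] share a coset of [L], and their quotient is a positive power in
    [L]. *)
Lemma infinite_order_no_finite_index K L x : subgroup L ->
  finite_set (left_cosets K L) -> (forall n, K (x ^+ n)) ->
  exists2 n, (0 < n)%N & L (x ^+ n).
Proof.
move=> sL fin Kx; apply: contrapT => nL; apply: infinite_nat.
pose f n := [set x ^+ n * z | z in L].
have <- : f @^-1` (left_cosets K L) = setT.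
  by rewrite eqEsubset; split=> // n _; exists (x ^+ n).
apply: finite_preimage fin.
suff ltf m n : (m < n)%N -> f m <> f n.
  move=> m n _ _ fmn; apply/eqP; apply: contrapT => /negP.
  by rewrite neq_ltn => /orP[] /ltf; [|move/nesym]; apply.
move=> ltmn /(left_coset_inj sL) Lmn; apply: nL; exists (n - m)%N.
  by rewrite subn_gt0.
by rewrite -(mulKg (x ^+ m) (x ^+ (n - m))) -expgnDr subnKC // ltnW.
Qed.

End Subgroups.

(** * Word metrics *)

Definition dist (G : groupType) (l : G -> nat) (x y : G) : nat :=
  l (x^-1 * y)%g.

(* [lia] compares atoms syntactically, whereas rewriting leaves the group
   operation of [G] in several convertible forms. *)
Ltac dlia :=
  repeat match goal with
    | H : is_true (leq _ _) |- _ => revert H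
    | H : @eq nat _ _ |- _ => revert H
  end;
  repeat match goal with |- context [dist ?l ?x ?y] =>
    let a := fresh "a" in set a := (dist l x y); clearbody a end;
  repeat match goal with |- context [?l ?x] =>
    is_var l; match type of l with Group.sort _ -> _ =>
      let a := fresh "a" in set a := (l x); clearbody a end end;
  lia.

Section WordMetrics.
Variable G : groupType.
Local Open Scope group_scope.
Implicit Types (l : G -> nat) (x y z w g u v p : G) (H K L : set G).


(** The interface to the Cayley graph, which keeps the hyperbolic geometry in [nat]: [wl_geod]
    expresses geodesicity and [wl_ball] local finiteness. *)
Record word_length l : Prop := WordLength {
  wl1 : l 1 = 0%N;
  wlV : forall x, l x^-1 = l x;
  wlM : forall x y, (l (x * y)%g <= l x + l y)%N;
  wl_geod : forall x i, (i <= l x)%N ->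
    exists2 y, l y = i & dist l y x = (l x - i)%N;
  wl_ball : forall n, finite_set [set x | (l x <= n)%N] }.

(* Gromov's inequality without base point or division by 2: [delta] is twice
   the constant of the usual inequality for Gromov products. *)
Definition four_point l (delta : nat) : Prop := forall x y z w,
  (dist l x z + dist l y w <=
     maxn (dist l x y + dist l z w) (dist l x w + dist l y z) + delta)%N.

(* Quasiconvexity of a subgroup [H]: the points [m] of the second hypothesis are
   exactly those lying on a geodesic from 1 to [h]. *)
Definition word_quasiconvex l (D : nat) H : Prop := forall h m, H h ->
  (l m + dist l m h = l h)%N -> exists2 q, H q & (dist l m q <= D)%N.

Section Length.
Variables (l : G -> nat) (wl : word_length l).
Local Notation d := (dist l).

Lemma dist1 x : d 1 x = l x.
Proof. by rewrite /dist invg1 mul1g. Qed.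

Lemma distxx x : d x x = 0%N.
Proof. by rewrite /dist mulVg wl1. Qed.

Lemma distC x y : d x y = d y x.
Proof. by rewrite /dist -(wlV wl) invgM invgK. Qed.

Lemma dist_tri y x z : (d x z <= d x y + d y z)%N.
Proof.
rewrite /dist (_ : x^-1 * z = x^-1 * y * (y^-1 * z)); first exact: wlM.
by rewrite !mulgA mulgK.
Qed.

Lemma distM g x y : d (g * x) (g * y) = d x y.
Proof. by rewrite /dist invgM !mulgA mulgVK. Qed.

Lemma dist_mulr x y : d x (x * y) = l y.
Proof. by rewrite /dist mulKg. Qed.

Lemma dist_geod u v i : (i <= d u v)%N ->
  exists2 m, d u m = i & d m v = (d u v - i)%N.
Proof.
move=> /(wl_geod wl)[y ly dy]; exists (u * y); first by rewrite dist_mulr.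
by rewrite -dy -(distM u^-1) mulKg.
Qed.

Section Hyperbolic.
Variables (delta : nat) (hyp : four_point l delta).

Lemma word_quasiconvex_near H D C g u v p : subgroup H -> word_quasiconvex l D H ->
  H (g^-1 * u) -> H (g^-1 * v) -> (d u p + d p v <= d u v + C)%N ->
  exists2 q, H q & (d p (g * q)%g <= C + D + delta + 1)%N.
Proof.
move=> sH qH Hu Hv puv.
(* The Gromov product of [p] and [v] at [u], rounded down (whence the extra 1). The four-point
   inequality puts [p] close to the point [m] at this distance from [u] on a geodesic. *)
pose i := ((d u p + d u v - d p v)./2)%N.
have i_le : (i <= d u v)%N.
  by have := dist_tri v u p; rewrite /i (distC v p); dlia.
have [m dum dmv] := dist_geod i_le.
have pm : (d p m <= C + delta + 1)%N.
  have := hyp u p v m; have := dist_tri u p v; have := dist_tri v u p.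
  have := dist_tri p u v.
  by rewrite (distC v m) (distC v p) (distC p u) dum dmv /i; dlia.
have := qH ((g^-1 * u)^-1 * (g^-1 * v)) (u^-1 * m).
case=> [||q Hq dq].
- by apply: subgroupM => //; apply: subgroupV.
- rewrite -/(d u m) dum invgM invgK !mulgA mulgK distM dmv -/(d u v);
  exact: subnKC.
exists (g^-1 * u * q); first exact: subgroupM.
rewrite !mulgA mulgV mul1g; have := dist_tri m p (u * q).
have -> : d m (u * q) = d (u^-1 * m) q by rewrite -(distM u^-1 m) mulKg.
dlia.
Qed.

(** * Elements whose powers form a quasigeodesic *)

Section Loxodromic.
Variables (x : G) (C : nat).
Hypotheses (xC : (2 * l x <= l (x ^+ 2) + C)%N) (x_big : (C + 2 * delta < l x)%N).

(** Local to global: [xC] bounds the Gromov product of [x^-1] and [x] at 1. In the four-point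
    inequality, the unwanted alternative contradicts the induction hypothesis because [x] is
    long. *)
Lemma loxodromic_step n : (l (x ^+ n) + l x <= l (x ^+ n.+1) + C + delta)%N.
Proof.
elim: n => [|n IHn]; first by rewrite expg0 expg1 (wl1 wl); dlia.
have := hyp x^-1 1 x (x ^+ n.+1).
have -> : d x^-1 1 = l x by rewrite distC dist1 (wlV wl).
have -> : d x^-1 x = l (x ^+ 2) by rewrite /dist invgK.
have -> : d x (x ^+ n.+1) = l (x ^+ n) by rewrite expgS dist_mulr.
have -> : d x^-1 (x ^+ n.+1) = l (x ^+ n.+2) by rewrite /dist invgK -expgS.
by rewrite !dist1; dlia.
Qed.

Lemma loxodromic_ge n : (n <= l (x ^+ n))%N.
Proof. by elim: n => // n IHn; have := loxodromic_step n; dlia. Qed.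

Lemma loxodromic_infinite_order : infinite_order x.
Proof. by move=> n n0 xn; have := loxodromic_ge n; rewrite xn (wl1 wl); dlia. Qed.

(** Two uses of [loxodromic_step] exclude one alternative of the four-point inequality. The outcome
    bounds the Gromov product of opposite powers, so that 1 is near every geodesic joining them. *)
Lemma loxodromic_product m n :
  (l (x ^+ m) + l (x ^+ n) <= l (x ^+ (m + n)) + C + 2 * delta)%N.
Proof.
case: m => [|m]; first by rewrite expg0 (wl1 wl) add0n; dlia.
have := hyp 1 x^-1 (x ^- m.+1) (x ^+ n).
rewrite !dist1 !(wlV wl).
have -> : d x^-1 (x ^+ n) = l (x ^+ n.+1) by rewrite /dist invgK -expgS.
have -> : d (x ^- m.+1) (x ^+ n) = l (x ^+ (m.+1 + n)).
  by rewrite /dist invgK -expgnDr.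
have -> : d x^-1 (x ^- m.+1) = l (x ^+ m).
  by rewrite distC /dist invgK expgSr mulgK.
by have := loxodromic_step m; have := loxodromic_step n; dlia.
Qed.

Lemma loxodromic_conj H D g n : subgroup H -> word_quasiconvex l D H -> (0 < n)%N ->
  conj_set H g (x ^+ n) ->
  let r := (C + 4 * delta + D + delta + 1)%N in
  exists b1 h b2, [/\ (l b1 <= r)%N, H h, (l b2 <= r)%N & x = b1 * h * b2].
Proof.
move=> sH qH n0 xnH r.
(* A multiple of [n] keeps [x ^+ N] in the conjugate. Its size compared with [l g] makes the passage
   from [x ^+ N] and [x ^- N] to [v] and [u] cost [2 * delta] only, so that [r] is independent of
   [g]. *)
pose N := (n * (l g + C + 4 * delta + 2))%N.
have HN : conj_set H g (x ^+ N).
  by rewrite /N expgnA; apply: subgroupX => //; apply: subgroup_conj.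
pose u := x ^- N * g; pose v := x ^+ N * g.
have Hu : H (g^-1 * u).
  by rewrite mulgA; apply/conj_setE; apply: (subgroupV (subgroup_conj g sH)).
have Hv : H (g^-1 * v) by rewrite mulgA; apply/conj_setE.
have axis e : (e <= 1)%N ->
    exists2 q, H q & (d (x ^+ e) (g * q)%g <= r)%N.
  move=> e1; apply: (word_quasiconvex_near sH qH Hu Hv).
  set p := x ^+ e; pose u0 := x ^- N; pose v0 := x ^+ N.
  have N_big : (l g + C + 4 * delta + 2 <= N)%N by rewrite /N leq_pmull.
  have pu0 : d p u0 = l (x ^+ (N + e)).
    by rewrite distC /dist invgK -expgnDr.
  have pv0 : d p v0 = l (x ^+ (N - e)).
    by rewrite -(dist_mulr p) -expgnDr subnKC //; lia.
  have uv0 : d u0 v0 = l (x ^+ (N + N)) by rewrite /dist invgK -expgnDr.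
  have prod : (d p u0 + d p v0 <= d u0 v0 + C + 2 * delta)%N.
    rewrite pu0 pv0 uv0; have := loxodromic_product (N + e) (N - e).
    by rewrite (_ : N + e + (N - e) = N + N)%N; dlia.
  have := loxodromic_ge (N + e); have := loxodromic_ge (N - e); rewrite -pu0 -pv0.
  have du : d u u0 = l g by rewrite distC dist_mulr.
  have dv : d v v0 = l g by rewrite distC dist_mulr.
  have := hyp p u0 u v0; have := hyp p v0 v u.
  have := dist_tri u p u0; have := dist_tri v p v0.
  rewrite (distC u p) (distC v u) (distC v0 u) (distC u0 u) (distC v0 v) du dv.
  by rewrite (distC u0 v0); rewrite (distC v0 u0); dlia.
have [//|q1 Hq1 d1] := axis 0%N; have [//|q2 Hq2 d2] := axis 1%N.
rewrite expg0 dist1 in d1; rewrite expg1 distC in d2.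
exists (g * q1), (q1^-1 * q2), ((g * q2)^-1 * x); split=> //.
  by apply: subgroupM => //; apply: subgroupV.
by rewrite invgM !mulgA mulgK mulgK mulgV mul1g.
Qed.

End Loxodromic.
End Hyperbolic.
End Length.
End WordMetrics.

(** * Stability of quasigeodesics *)

Lemma exp_le_linear a b q : (2 ^ q <= a + b * q -> q <= 2 * a + 2 * b)%N.
Proof.
have q2 : (q * q <= 2 * 2 ^ q)%N.
  elim: q => // q IHq; rewrite expnS.
  by have := ltn_expl q (isT : 1 < 2)%N; lia.
case: q q2 => // q q2 qab.
have : (q.+1 * q.+1 <= (2 * a + 2 * b) * q.+1)%N by nia.
by rewrite leq_pmul2r.
Qed.

Section Morse.
Variable G : groupType.
Local Open Scope group_scope.
Implicit Types (x y z w g u v m : G) (H K : set G).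
Variables (l : G -> nat) (wl : word_length l).
Local Notation d := (dist l).
Variables (delta : nat) (hyp : four_point l delta).

Section Path.
Variables (p : nat -> G) (n L lam : nat).
Hypothesis p_step : forall i, (i < n)%N -> (d (p i) (p i.+1) <= L)%N.
Hypothesis p_qgeod :
  forall i j, (i <= j <= n)%N -> (j - i <= lam * d (p i) (p j))%N.

(** Bisection: each of the [k] halvings costs one [delta], and a single step costs [L]. This bounds
    below the Gromov product at [m] of two points of a path avoiding a ball around [m]. *)
Lemma chain_product k m R i j : (i <= j <= n)%N -> (j <= i + 2 ^ k)%N ->
  (forall t, (t <= n)%N -> (R <= d m (p t))%N) ->
  (d (p i) (p j) + 2 * R <= d m (p i) + d m (p j) + L + k * delta)%N.
Proof.
elim: k i j => [|k IHk] i j ij jk far.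
  have Ri := far i; have Rj := far j.
  have [->|ne] := eqVneq j i; first by rewrite distxx //; lia.
  have -> : j = i.+1 by lia.
  have := p_step (i := i); have := far i.+1; lia.
have [jk'|jk'] := leqP j (i + 2 ^ k).
  by have := IHk i j ij jk' far; rewrite (mulSn k); lia.
set t := (i + 2 ^ k)%N in jk'.
have it : (i <= t <= n)%N by rewrite leq_addr; lia.
have tj : (t <= j <= n)%N by lia.
have jt : (j <= t + 2 ^ k)%N by rewrite /t; rewrite expnS in jk; lia.
have := IHk i t it (leqnn _) far; have := IHk t j tj jt far.
have := hyp m (p i) (p t) (p j).
by rewrite (mulSn k); move: (k * delta)%N => kd; lia.
Qed.

Definition on_geod m := (d (p 0) m + d m (p n) = d (p 0) (p n))%N.

(** The choice of [e] treats both sides of [m] at once. The fourth conclusion says that [y] and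
    [p t] have Gromov product at least [R] at [m]. *)
Lemma step_back R m e : (e = 0 \/ e = n)%N -> on_geod m ->
  (forall t, (t <= n)%N -> (R <= d m (p t))%N) ->
  (forall y, on_geod y -> exists2 t, (t <= n)%N & (d y (p t) <= R)%N) ->
  exists y t, [/\ (t <= n)%N, (d m y <= 2 * R)%N, (d y (p t) <= R)%N,
    (d y (p t) + 2 * R <= d m y + d m (p t))%N &
    (d (p e) y + d y m = d (p e) m)%N].
Proof.
move=> e0n mg far near.
have en : (e <= n)%N by lia.
(* An end of the geodesic closer to [m] than [2 * R] itself serves as [y]. *)
have [mR|mR] := leqP (2 * R) (d m (p e)); last first.
  have := far e en; exists (p e), e.
  by split; rewrite ?(distxx wl) //; lia.
have [y my ye] := dist_geod wl mR.
have yg : on_geod y.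
  rewrite /on_geod in mg *.
  have := distC wl m y; have := distC wl m (p 0); have := distC wl y (p 0).
  case: e0n => ?; subst e.
    by have := dist_tri wl m y (p n); have := dist_tri wl y (p 0) (p n); lia.
  by have := dist_tri wl m (p 0) y; have := dist_tri wl y (p 0) (p n); lia.
have [t tn yt] := near y yg.
exists y, t; split=> //; first by rewrite my.
  by have := far t tn; lia.
by have := distC wl (p e) y; have := distC wl y m; have := distC wl (p e) m; lia.
Qed.

(** Here [2 ^ q <= a + b * q] is the inequality reached for the logarithm [q] of the path length;
    [exp_le_linear] turns it into the bound [2 * a + 2 * b]. *)
Definition morse_bound : nat :=
  let a := (3 * lam * (L + 3 * delta) + 1)%N in
  let b := (3 * lam * delta)%N in L + (2 * a + 2 * b + 3) * delta.

(* Take a point [m] of the geodesic at maximal distance [R] from the path, and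
   points [y], [z] of the geodesic at distance [2 R] on both sides of [m]: the
   points of the path close to [y] and [z] are joined by a piece of the path of
   length linear in [R], whereas a path avoiding the ball of radius [R] around
   [m] needs length exponential in [R]. *)
Lemma morse m : on_geod m -> exists2 t, (t <= n)%N & (d m (p t) <= morse_bound)%N.
Proof.
move=> mg.
pose P R := `[< exists2 m, on_geod m & forall t, (t <= n)%N -> (R <= d m (p t))%N >].
have P0 : exists R, P R by exists 0%N; apply/asboolP; exists m.
have Pmax R : P R -> (R <= d (p 0) (p n))%N.
  move=> /asboolP[m' mg' /(_ 0%N)]; rewrite distC //.
  by move: mg'; rewrite /on_geod; lia.
have [R /asboolP[m' mg' far] Rmax] := ex_maxnP P0 Pmax.
have near y : on_geod y -> exists2 t, (t <= n)%N & (d y (p t) <= R)%N.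
  move=> yg; apply: contrapT => ny.
  suff /Rmax : P R.+1 by rewrite ltnn.
  apply/asboolP; exists y => // t tn; rewrite ltnNge; apply/negP => yt.
  by apply: ny; exists t.
suff RD : (R <= morse_bound)%N.
  have [t tn mt] := near m mg; exists t => //; lia.
have [y [i [iN my yi myi ey]]] := step_back (or_introl erefl) mg' far near.
have [z [j [jN mz zj mzj ez]]] := step_back (or_intror erefl) mg' far near.
(* The points [p i] and [p j] turn out to be within [6 * R], hence at most [6 * lam * R] steps
   apart: [q.+1] halvings suffice. *)
pose q := trunc_log 2 (6 * lam * R + 1).
have q_le : (2 ^ q <= 6 * lam * R + 1)%N by apply: trunc_logP; rewrite // addn1.
have q_lt : (6 * lam * R + 1 < 2 ^ q.+1)%N by apply: trunc_log_ltn.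
have pij : (d (p i) (p j) <= 6 * R)%N.
  have := dist_tri wl y (p i) (p j); have := dist_tri wl m' y (p j).
  have := dist_tri wl z m' (p j).
  by have := distC wl (p i) y; have := distC wl y m'; lia.
have chain : (d (p i) (p j) + 2 * R <=
    d m' (p i) + d m' (p j) + L + q.+1 * delta)%N.
  have [ij|/ltnW ji] := leqP i j.
    apply: chain_product => //; first by rewrite ij.
    by have := p_qgeod (i := i) (j := j); rewrite ij jN => /(_ isT); nia.
  rewrite distC // (addnC (d m' (p i))); apply: chain_product => //.
    by rewrite ji.
  have := p_qgeod (i := j) (j := i); rewrite ji iN (distC wl (p j)) => /(_ isT).
  by nia.
(* As [m'] lies between [y] and [z], their product at [m'] vanishes, whereas the chain [y], [p i],
   [p j], [z] bounds it below. *)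
have R2 : (2 * R <= L + (q + 3) * delta)%N.
  have yz : (d m' y + d m' z <= d y z)%N.
    have := dist_tri wl y (p 0) (p n); have := dist_tri wl z y (p n).
    have := distC wl y m'; have := distC wl (p n) z; have := distC wl z m'.
    by have := distC wl (p n) m'; move: mg'; rewrite /on_geod; lia.
  have := hyp m' y (p i) z; have := hyp m' (p i) (p j) z.
  have := distC wl (p j) z; have := distC wl (p i) y.
  have -> : (q + 3 = q.+1 + 2)%N by lia.
  by move: chain; rewrite mulnDl; move: (q.+1 * delta)%N => qd *; lia.
have /exp_le_linear q_ab : (2 ^ q <=
    3 * lam * (L + 3 * delta) + 1 + 3 * lam * delta * q)%N by nia.
by rewrite /morse_bound; nia.
Qed.

End Path.
End Morse.

(** * Subgroups fixing a boundary point *)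

Lemma ultra_bounded (U : set_system nat) (u : nat -> nat) m :
  UltraFilter U -> U [set n | (u n <= m)%N] -> exists v, U [set n | u n = v].
Proof.
move=> UU; elim: m => [|m IHm] Um.
  by exists 0%N; apply: filterS Um => n /=; rewrite leqn0 => /eqP.
have [Um1|nUm1] := in_ultra_setVsetC [set n | u n = m.+1] UU; first by exists m.+1.
apply: IHm; apply: filterS (filterI Um nUm1) => n /= [].
by rewrite leq_eqVlt => /orP[/eqP|].
Qed.

(** The limit along an ultrafilter containing all final segments: bounded integer values attain it
    on a member of the ultrafilter, and finitely many members intersect. *)
Lemma bounded_limit (T : eqType) (b : T -> nat) (s_ : nat -> T -> int) :
  (forall n x, (b x <= n)%N -> (`|s_ n x| <= b x)%N) ->
  exists s : T -> int, forall (xs : seq T) m,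
    exists2 n, (m <= n)%N & {in xs, s =1 s_ n}.
Proof.
move=> bs; have [U [UU UF]] := ultraFilterLemma eventually_filter.
have ev m : U [set n | (m <= n)%N] by apply: UF; exists m.
have /choice[s sP] x : exists v, U [set n | s_ n x = v].
  have [|v Uv] := @ultra_bounded U (fun n => `|(s_ n x + (b x)%:Z)%R|%N) (2 * b x) UU.
    by apply: filterS (ev (b x)) => n /= /bs; lia.
  exists (v%:Z - (b x)%:Z)%R.
  apply: filterS (filterI Uv (ev (b x))) => n /= [vE /bs]; lia.
exists s => xs m; have PU := @ultra_proper _ _ UU.
have : U [set n | (m <= n)%N /\ {in xs, s =1 s_ n}].
  elim: xs => [|x xs IHxs]; first by apply: filterS (ev m) => n /= ?; split.
  apply: filterS (filterI (sP x) IHxs) => n /= [snx [mn sn]]; split=> // y.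
  by rewrite inE => /predU1P[->|/sn].
by case/(filter_ex) => n [mn sn]; exists n.
Qed.

Section FixedEnd.
Variable G : groupType.
Local Open Scope group_scope.
Implicit Types (x y z w f g h : G) (H K L : set G).
Variables (l : G -> nat) (wl : word_length l).
Local Notation d := (dist l).
Variables (delta : nat) (hyp : four_point l delta).
Variable K : set G.
Hypothesis sK : subgroup K.

(* Finitary form of "[K] fixes a point of the boundary": the points [k] play
   the role of a sequence converging to a fixed point. *)
Definition fixes_end : Prop := forall n C : nat, exists2 k, K k &
  forall f, K f -> (l f <= n)%N -> (d (f * k)%g k + C <= l (f * k)%g + l k)%N.

(** The last clause controls level sets: elements of equal value move one point [y], depending on
    [n], to nearby points. *)
Definition quasimorphism_on n (s : G -> int) : Prop :=
  [/\ s 1 = 0%R,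
      forall f, K f -> (l f <= n)%N -> (`|s f| <= l f)%N,
      forall f g, K f -> K g -> (l f <= n)%N -> (l g <= n)%N ->
        (`|(s (f * g)%g - s f - s g)%R| <= delta)%N &
      exists y, forall f g, K f -> K g -> (l f <= n)%N -> (l g <= n)%N ->
        s f = s g -> (d (f * y)%g (g * y)%g <= 4 * delta)%N].

(* [s] is the Busemann function of the fixed end, evaluated along the orbit. *)
Lemma busemann_quasimorphism n : fixes_end -> exists s, quasimorphism_on n s.
Proof.
move=> /(_ n (4 * n + 4 * delta + 4)%N)[k Kk fixk].
pose s f := ((l (f * k)%g)%:Z - (l k)%:Z)%R.
have lfk f : (l (f * k)%g <= l f + l k)%N by apply: wlM.
have lkf f : (l k <= l f + l (f * k)%g)%N.
  by rewrite -(wlV wl f) -{1}(mulKg f k); apply: wlM.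
have k_big : (2 * n + 2 * delta + 2 <= l k)%N.
  have := fixk 1 (subgroup1 sK); rewrite (wl1 wl) mul1g distxx // => /(_ isT).
  by lia.
exists s; split.
- by rewrite /s mul1g GRing.subrr.
- by move=> f Kf lf; have := lfk f; have := lkf f; rewrite /s; lia.
- move=> f g Kf Kg lf lg.
  have := fixk g Kg lg; have := lfk f; have := lkf f.
  have := hyp f^-1 1 (g * k) k; have := hyp f^-1 1 k (g * k).
  have E a : d f^-1 a = l (f * a) by rewrite /dist invgK.
  rewrite !E !dist1 mulg1 (distC wl k) /s -mulgA.
  have := lfk f; have := lkf f; have := wlM wl f (g * k).
  have : (l (g * k)%g <= l f + l (f * (g * k))%g)%N.
    by rewrite -(wlV wl f) -{1}(mulKg f (g * k)); apply: wlM.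
  by dlia.
(* Far enough from 1 to dominate all [f] of length at most [n], yet before the geodesics from 1 to
   [k], [f * k] and [g * k] diverge. *)
have [|y ly dyk] := wl_geod wl (x := k) (i := n + delta + 1).
  by lia.
exists y => f g Kf Kg lf lg sfg.
have sfg' : l (f * k) = l (g * k) by move: sfg; rewrite /s; lia.
have fy u : K u -> (l u <= n)%N ->
    (l (u * y)%g + l k <= l (u * k)%g + l y + delta)%N.
  move=> Ku lu; have := hyp u^-1 1 y k.
  have E a : d u^-1 a = l (u * a) by rewrite /dist invgK.
  rewrite !E !dist1 mulg1 dyk ly.
  have : (l y <= l u + l (u * y)%g)%N.
    by rewrite -(wlV wl u) -{1}(mulKg u y); apply: wlM.
  have := lkf u.
  by rewrite ly; dlia.
have fyk u : d (u * y) (u * k) = (l k - l y)%N by rewrite distM dyk ly.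
have := fy f Kf lf; have := fy g Kg lg.
have := fixk f Kf lf; have := fixk g Kg lg.
have := fyk f; have := fyk g; have := lfk f; have := lkf f; have := lfk g.
have := hyp 1 (f * k) k (g * k).
have := hyp 1 (f * y) (f * k) (g * k).
have := hyp 1 (f * y) (g * k) (g * y).
rewrite !dist1 (distC wl k) (distC wl (g * k) (g * y)) sfg' ly.
by dlia.
Qed.

(** An element is encoded by its value and by the position of its translate of [y] relative to that
    of a reference element of equal value. The count does not involve [n]. *)
Lemma quasimorphism_count B n s M (xs : seq G) :
  (forall x, (l x <= 4 * delta)%N -> x \in B) -> quasimorphism_on n s ->
  uniq xs ->
  (forall x, x \in xs -> [/\ K x, (l x <= n)%N & (`|s x| <= M)%N]) ->
  (size xs <= (2 * M + 1) * size B)%N.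
Proof.
move=> inB [_ _ _ [y yP]] Uxs xsP.
pose ref v := nth 1 xs (find (fun x => s x == v) xs).
have refP x : x \in xs -> ref (s x) \in xs /\ s (ref (s x)) = s x.
  move=> xxs; have hasx : has (fun z => s z == s x) xs by apply/hasP; exists x.
  by split; [rewrite mem_nth // -has_find | apply/eqP/(nth_find 1 hasx)].
pose code x := (`|(s x + M%:Z)%R|%N, (ref (s x) * y)^-1 * (x * y)).
have code_inj : {in xs &, injective code}.
  move=> x z xxs zxs [sxz].
  have -> : s x = s z by have [_ _] := xsP x xxs; have [_ _] := xsP z zxs; lia.
  by move=> /mulgI/mulIg.
have sub : {subset map code xs <= [seq (i, b) | i <- iota 0 (2 * M + 1), b <- B]}.
  move=> _ /mapP[x xxs ->]; have [Kx lx sx] := xsP x xxs.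
  have [rxs rx] := refP x xxs; have [Kr lr _] := xsP _ rxs.
  apply: allpairs_f; first by rewrite mem_iota; lia.
  exact/inB/yP.
have := uniq_leq_size _ sub; rewrite map_inj_in_uniq // => /(_ Uxs).
by rewrite size_map size_allpairs size_iota.
Qed.

Definition proper_quasimorphism (s : G -> int) : Prop :=
  [/\ s 1 = 0%R,
      forall f g, K f -> K g -> (`|(s (f * g)%g - s f - s g)%R| <= delta)%N &
      forall M, finite_set [set f | K f /\ (`|s f| <= M)%N]].

(** A pointwise limit of the functions on balls: each relation involves finitely many elements, and
    the count uniform in [n] keeps sublevel sets finite. *)
Lemma fixes_end_quasimorphism :
  fixes_end -> exists s, proper_quasimorphism s.
Proof.
move=> fix_.
have /choice[s_ sP] n : exists s, quasimorphism_on n s.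
  exact: busemann_quasimorphism.
pose t n f := if `[< K f >] then s_ n f else 0%R.
have tK n f : K f -> t n f = s_ n f by rewrite /t; case: asboolP.
have [n f lf|s slim] := @bounded_limit _ l t.
  rewrite /t; case: asboolP => [Kf|//]; by have [_ + _ _] := sP n; apply.
exists s; split.
- have [n _ sn] := slim [:: 1] 0%N; rewrite sn ?mem_head // tK; last exact: subgroup1.
  by have [] := sP n.
- move=> f g Kf Kg; have Kfg := subgroupM sK Kf Kg.
  have [n fn sn] := slim [:: f; g; f * g] (l f + l g)%N.
  rewrite !sn ?inE ?eqxx ?orbT // !tK //.
  by have [_ _ + _] := sP n; apply=> //; lia.
move=> M; apply: contrapT => inf.
have [B BP] := (finite_seqP _).1 (wl_ball wl (4 * delta)).
have inB x : (l x <= 4 * delta)%N -> x \in B.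
  by move=> lx; have : [set` B] x by rewrite -BP.
have [X XP szX] := infinite_set_fset ((2 * M + 1) * size B).+1 inf.
pose m := \max_(x <- finmap.enum_fset X) l x.
have [n mn sn] := slim (finmap.enum_fset X) m.
suff : (size (finmap.enum_fset X) <= (2 * M + 1) * size B)%N.
  by rewrite leqNgt szX.
apply: quasimorphism_count inB (sP n) (finmap.fset_uniq X) _ => x xX.
have [Kx sx] := XP x xX; split=> //; last by rewrite -tK // -sn.
by apply: leq_trans mn; rewrite /m (big_rem x) //= leq_maxl.
Qed.

(** * Subgroups carrying a proper quasimorphism *)

Section QuasimorphismConsequences.
Variable s : G -> int.
Hypothesis sP : proper_quasimorphism s.

(** Once [s f] exceeds [2 * delta] in absolute value, the defect cannot stop [s] from growing
    linearly along the powers of [f]. *)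
Lemma quasimorphism_infinite_order :
  infinite_set K -> exists2 f, K f & infinite_order f.
Proof.
have [s1 sM sfin] := sP => infK.
have [f Kf sf] : exists2 f, K f & (2 * delta < `|s f|)%N.
  apply: contrapT => nf; apply: infK; apply: sub_finite_set (sfin (2 * delta)%N).
  move=> f Kf; split=> //; rewrite leqNgt; apply/negP => sf.
  by apply: nf; exists f.
exists f => // n n0 fn.
have grow i : ((0 < s f)%R -> (i%:Z <= s (f ^+ i))%R) /\
              ((s f < 0)%R -> (s (f ^+ i) <= - i%:Z)%R).
  elim: i => [|i]; first by rewrite expg0 s1.
  by have := sM f (f ^+ i) Kf (subgroupX i sK Kf); rewrite -expgS; dlia.
by have := grow n; rewrite fn s1; lia.
Qed.

Lemma quasimorphism_finite_index L e : subgroup L -> L `<=` K ->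
  infinite_order e -> L e -> finite_set (left_cosets K L).
Proof.
have [s1 sM sfin] := sP => sL LK infe Le.
have [m sm] : exists m, (2 * delta < `|s (e ^+ m)|)%N.
  apply: contrapT => ne; apply: infinite_nat.
  have eK : (fun n => e ^+ n) @` setT `<=` [set f | K f /\ (`|s f| <= 2 * delta)%N].
    move=> _ [n _ <-]; split; first by apply: LK; apply: subgroupX.
    by rewrite leqNgt; apply/negP => sn; apply: ne; exists n.
  have ltf i j : (i < j)%N -> e ^+ i <> e ^+ j.
    move=> ij eij; apply: (infe (j - i)%N); first by rewrite subn_gt0.
    by rewrite expgnFr ?(ltnW ij) // eij mulgV.
  suff : {in [set: nat] &, injective (fun n => e ^+ n)}.
    move=> /inj_card_eq/eq_finite_set <-.
    exact: sub_finite_set eK (sfin _).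
  move=> i j _ _ eij; apply/eqP; apply: contrapT => /negP.
  by rewrite neq_ltn => /orP[] /ltf; rewrite eij.
pose f := e ^+ m; have Lf : L f by apply: subgroupX.
(* Above this threshold, multiplying by [f] or [f^-1] according to signs lowers the absolute value
   without overshooting 0. Every coset thus has a representative in a finite sublevel set. *)
have [M ME] : exists M, M = (`|s f| + delta)%N by eexists.
have red b h : K h -> (`|s h| <= b + M)%N ->
    exists2 z, L z & K (h * z) /\ (`|s (h * z)%g| <= M)%N.
  elim: b h => [|b IHb] h Kh sh.
    by exists 1; rewrite ?mulg1 //; apply: subgroup1.
  have [hM|hM] := leqP `|s h| M.
    by exists 1; rewrite ?mulg1 //; apply: subgroup1.
  have Kf := LK f Lf; have LVf := subgroupV sL Lf; have KVf := LK _ LVf.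
  have [z Lz [Kz sz]] : exists2 z, L z & K (h * z) /\ (`|s (h * z)%g| <= b + M)%N.
    have := sM h f Kh Kf; have := sM (h * f^-1) f (subgroupM sK Kh KVf) Kf.
    rewrite mulgVK => h1 h2.
    have [sgn|sgn] : ((0 <= s h) && (0 <= s f) || (s h < 0) && (s f < 0))%R \/
        ((0 <= s h) && (s f < 0) || (s h < 0) && (0 <= s f))%R by lia.
      exists f^-1 => //; split; first exact: subgroupM.
      by move: sgn sm; rewrite -/f; dlia.
    exists f => //; split; first exact: subgroupM.
    by move: sgn sm; rewrite -/f; dlia.
  have [z' Lz' [Kz' sz']] := IHb _ Kz sz.
  by exists (z * z'); rewrite ?mulgA //; apply: subgroupM.
apply: sub_finite_set (finite_image (fun u => [set u * z | z in L]) (sfin M)).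
move=> _ [h Kh <-].
have [z Lz hz] := red `|s h|%N h Kh (leq_addr _ _).
exists (h * z) => //; apply: left_coset_eq => //.
by rewrite invgM mulgVK; apply: subgroupV.
Qed.

End QuasimorphismConsequences.
End FixedEnd.

(** * Elements avoiding the conjugates *)

Section NonElementary.
Variable G : groupType.
Local Open Scope group_scope.
Implicit Types (x y z w f g h k : G).
Variables (l : G -> nat) (wl : word_length l).
Local Notation d := (dist l).
Variables (delta : nat) (hyp : four_point l delta).
Variable K : set G.
Hypothesis sK : subgroup K.

(** Some [f] makes [f * k] diverge from [k], so [k^-1] cannot be close in direction to both. Either
    [k] itself works, with [f = 1], or [f * k] does, its inverse being within [n] of [k^-1]. *)
Lemma not_fixes_end : ~ fixes_end l K -> exists n C : nat, forall k, K k ->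
  exists f, [/\ K f, (l f <= n)%N &
    (2 * l (f * k)%g <= l ((f * k)%g ^+ 2) + C)%N].
Proof.
move=> nfix; have [n [C nC]] : exists n C, forall k, K k ->
    exists f, [/\ K f, (l f <= n)%N & (l (f * k)%g + l k < d (f * k)%g k + C)%N].
  apply: contrapT => nn; apply: nfix => n C; apply: contrapT => nk.
  apply: nn; exists n, C => k Kk; apply: contrapT => nf; apply: nk; exists k => //.
  move=> f Kf lf; rewrite leqNgt; apply/negP => lt; apply: nf.
  by exists f; split.
exists n, (C + delta + 2 * n)%N => k Kk.
have sq u : d u u^-1 = l (u ^+ 2).
  by rewrite /dist -(wlV wl) invgM !invgK expg2.
have [f [Kf lf fk]] := nC k Kk.
have := hyp 1 (f * k) k^-1 k; rewrite !dist1 (wlV wl) (distC wl k^-1) sq.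
have [kk _|kk] := leqP (2 * l k) (l (k ^+ 2) + (C + delta)).
  exists 1; split; rewrite ?mul1g ?(wl1 wl) //; first exact: subgroup1.
  by lia.
move=> h4; exists f; split=> //; rewrite -sq.
have := dist_tri wl (f * k)^-1 (f * k) k^-1.
have : d (f * k)^-1 k^-1 = l f by rewrite invgM distC // dist_mulr (wlV wl).
have := wlM wl f k.
by dlia.
Qed.

Variables (s : nat) (H : 'I_s -> set G) (D : nat).
Hypotheses (s_gt0 : (0 < s)%N) (sH : forall j, subgroup (H j)).
Hypothesis qH : forall j, word_quasiconvex l D (H j).
Hypothesis infH :
  forall (j : 'I_s) g, infinite_index K (K `&` conj_set (H j) g).

Lemma double_coset_avoid r : exists2 k, K k & forall j a h b,
  (l a <= r)%N -> H j h -> (l b <= r)%N -> k <> a * h * b.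
Proof.
apply: contrapT => nk.
have [B BP] := (finite_seqP _).1 (wl_ball wl r).
have inB x : (l x <= r)%N -> x \in B.
  by move=> lx; have : [set` B] x by rewrite -BP.
(* The set [a H b] is the translate by [a * b] of the conjugate of [H] by [b^-1]. *)
pose L (i : 'I_s * G) := conj_set (H i.1) i.2^-1.
have [| |[j b] _ /=] := @neumann_cover _ _ L K
    [seq (j, b) | j <- enum 'I_s, b <- B] [seq a * b | a <- B, b <- B] sK.
- by move=> i; apply: subgroup_conj.
- move=> k Kk; apply: contrapT => nak; apply: nk; exists k => // j a h b la Hh lb kE.
  apply: nak; exists (a * b); first by apply: allpairs_f; apply: inB.
  exists (j, b); first by apply: allpairs_f; rewrite ?mem_enum ?inB.
  by apply/conj_setE; rewrite /= kE invgK invgM !mulgA mulgV mul1g mulVg mul1g mulgK.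
exact: (infH (j := j) (g := b^-1)).
Qed.

Lemma infinite_index_element : exists2 x, K x & infinite_order x /\
  forall j g n, (0 < n)%N -> ~ conj_set (H j) g (x ^+ n).
Proof.
have [fixK|/not_fixes_end[n [C nC]]] := pselect (fixes_end l K).
  have infK : infinite_set K.
    have j := Ordinal s_gt0; move=> finK; apply: (infH (j := j) (g := 1)).
    exact: finite_image.
  have [t tP] := fixes_end_quasimorphism wl hyp sK fixK.
  have [x Kx xinf] := quasimorphism_infinite_order sK tP infK.
  exists x => //; split=> // j g n n0 xn; apply: (infH (j := j) (g := g)).
  apply: (quasimorphism_finite_index sK tP (e := x ^+ n)).
  - by apply: subgroupI => //; apply: subgroup_conj.
  - by move=> ? [].
  - by move=> m m0; rewrite -expgnA; apply: xinf; rewrite muln_gt0 n0.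
  - by split=> //; apply: subgroupX.
pose r := (C + 4 * delta + D + delta + 1)%N.
(* [r] is the radius of [loxodromic_conj]; the extra [n] absorbs [f^-1] when [f * k = b1 * h * b2]
   is solved for [k]. *)
have [k Kk kP] := double_coset_avoid (n + r).
have [f [Kf lf fkC]] := nC k Kk.
(* A short [k] would be the excluded product [k * 1 * 1]. *)
have k_big : (n + r < l k)%N.
  rewrite ltnNge; apply/negP => lk; apply: (kP (Ordinal s_gt0) k 1 1) => //.
  - exact: subgroup1.
  - by rewrite (wl1 wl).
  - by rewrite !mulg1.
have x_big : (C + 2 * delta < l (f * k)%g)%N.
  have : (l k <= l f + l (f * k)%g)%N.
    by rewrite -(wlV wl f) -{1}(mulKg f k); apply: wlM.
  by rewrite /r in k_big; dlia.
exists (f * k); first exact: subgroupM.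
split=> [|j g m m0 xm]; first exact: (loxodromic_infinite_order wl hyp fkC x_big).
have [b1 [h [b2 [lb1 Hh lb2 fkE]]]] :=
  loxodromic_conj wl hyp fkC x_big (sH j) (@qH j) m0 xm.
apply: (kP j (f^-1 * b1) h b2) => //.
- by apply: leq_trans (wlM wl _ _) _; rewrite (wlV wl) leq_add.
- by apply: leq_trans lb2 _; rewrite leq_addl.
- by rewrite -[k](mulKg f) fkE !mulgA.
Qed.

End NonElementary.

(** * The Cayley graph *)

Section Walks.
Variable G : groupType.
Local Open Scope group_scope.
Variable A : set G.
Hypothesis genA : finite_sym_generating A.
Implicit Types (u v w x y g : G) (l : G -> nat).

Lemma walk_cat m n u v w : walk A m u v -> walk A n v w -> walk A (m + n) u w.
Proof.
elim: m u => [|m IHm] u /=; first by move=> ->.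
by move=> [z uz zv] vw; exists z => //; apply: IHm.
Qed.

Lemma walk_split i n u v : (i <= n)%N -> walk A n u v ->
  exists2 w, walk A i u w & walk A (n - i) w v.
Proof.
elim: i n u => [|i IHi] n u; first by exists u; rewrite ?subn0.
case: n => // n lein [z uz /(IHi n z lein)[w zw wv]].
by exists w; rewrite ?subSS //; exists z.
Qed.

Lemma walk_mul g n u v : walk A n u v -> walk A n (g * u) (g * v).
Proof.
elim: n u => [|n IHn] u /=; first by move=> ->.
move=> [z uz /IHn zv]; exists (g * z) => //.
by rewrite /adjacent invgM !mulgA mulgVK.
Qed.

Lemma walk_sym n u v : walk A n u v -> walk A n v u.
Proof.
have [_ symA _] := genA.
elim: n u => [|n IHn] u /=; first by move=> ->.
move=> [z uz /IHn vz]; suff : walk A (n + 1) v u by rewrite addn1.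
by apply: walk_cat vz _; exists u => //; have := symA _ uz; rewrite invgM invgK.
Qed.

Lemma walk_ex x : exists n, walk A n 1 x.
Proof.
have [_ _ gen] := genA.
have : generated A x by rewrite gen.
move=> /(_ [set x | exists n, walk A n 1 x]); apply; split; last first.
  by move=> a Aa; exists 1%N, a => //; rewrite /adjacent invg1 mul1g.
apply/subgroupP; split=> [|y z [m my] [n nz]]; first by exists 0%N.
exists (m + n)%N; apply: walk_cat my _.
by have := walk_mul (y * z^-1) nz => /walk_sym; rewrite mulg1 mulgVK.
Qed.

Lemma walk_path n u w : walk A n u w -> exists v : nat -> G,
  [/\ v 0%N = u, v n = w & forall i, (i < n)%N -> adjacent A (v i) (v i.+1)].
Proof.
elim: n u => [|n IHn] u /=; first by move=> ->; exists (fun=> w).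
move=> [z uz /IHn[v [v0 vn vS]]].
exists (fun i => if i is j.+1 then v j else u); split=> // -[_|i /vS //].
by rewrite v0.
Qed.

Lemma path_walk (v : nat -> G) n i j :
  (forall i, (i < n)%N -> adjacent A (v i) (v i.+1)) -> (i <= j <= n)%N ->
  walk A (j - i) (v i) (v j).
Proof.
move=> vS; elim: j => [|j IHj] ij; first by have -> : i = 0%N by lia.
have [->|ne] := eqVneq i j.+1; first by rewrite subnn.
have -> : (j.+1 - i = j - i + 1)%N by lia.
apply: walk_cat (IHj _) _; first by lia.
by exists (v j.+1) => //; apply: vS; lia.
Qed.

Definition is_word_length l : Prop :=
  forall x, walk A (l x) 1 x /\ forall n, walk A n 1 x -> (l x <= n)%N.

Lemma is_word_length_ex : exists l, is_word_length l.
Proof.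
suff /choice[l lP] x : exists m, walk A m 1 x /\
    forall n, walk A n 1 x -> (m <= n)%N by exists l.
have ex : exists n, `[< walk A n 1 x >].
  by have [n nx] := walk_ex x; exists n; apply/asboolP.
case: (ex_minnP ex) => m /asboolP mx mmin; exists m; split=> // n nx.
by apply: mmin; apply/asboolP.
Qed.

Variable l : G -> nat.
Hypothesis lP : is_word_length l.

Lemma walk_dist u v : walk A (dist l u v) u v.
Proof.
by have [/(walk_mul u) + _] := lP (u^-1 * v); rewrite mulg1 mulVKg.
Qed.

Lemma dist_le_walk n u v : walk A n u v -> (dist l u v <= n)%N.
Proof.
move=> /(walk_mul u^-1); rewrite mulVg => nuv.
by have [_] := lP (u^-1 * v); apply.
Qed.

Lemma is_word_lengthP : word_length l.
Proof.
have dist1l x : dist l 1 x = l x by rewrite /dist invg1 mul1g.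
have lM x y : (l (x * y)%g <= l x + l y)%N.
  have [wx _] := lP x; have [/(walk_mul x) wy _] := lP y.
  by have [_] := lP (x * y); apply; apply: walk_cat wx _; rewrite mulg1 in wy.
split=> //.
- by apply/eqP; rewrite -leqn0; have [_] := lP 1; apply.
- suff le x : (l x^-1 <= l x)%N.
    by move=> x; apply/eqP; rewrite eqn_leq le -{1}[x]invgK le.
  have [/(walk_mul x^-1)/walk_sym wx _] := lP x.
  by have [_] := lP x^-1; apply; rewrite mulVg mulg1 in wx.
- move=> x i lei; have [/(walk_split lei)[y iy yx] _] := lP x.
  exists y; have := dist_le_walk iy; have := dist_le_walk yx; rewrite dist1l;
  by have := lM y (y^-1 * x); rewrite mulVKg /dist; lia.
move=> n; have [finA _ _] := genA.
have finW m : finite_set [set x | walk A m 1 x].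
  elim: m => [|m IHm].
    by apply: sub_finite_set (finite_set1 1) => x /= ->.
  apply: sub_finite_set (finite_image2 (fun x y => x * y) finA IHm).
  move=> x [a]; rewrite /adjacent invg1 mul1g => Aa /(walk_mul a^-1).
  rewrite mulVg => ax; exists a => //; exists (a^-1 * x) => //.
  by rewrite mulVKg.
elim: n => [|n IHn].
  by apply: sub_finite_set (finW 0%N) => x /=; rewrite leqn0 => /eqP x0;
    have [+ _] := lP x; rewrite x0.
have : finite_set ([set x | (l x <= n)%N] `|` [set x | walk A n.+1 1 x]).
  by rewrite finite_setU.
apply: sub_finite_set => x /=; rewrite leq_eqVlt ltnS => /orP[/eqP xn|]; last by left.
by right; have [+ _] := lP x; rewrite xn.
Qed.

(** [L] is the largest [l']-length of a generator. Used in both directions, this makes two word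
    metrics bi-Lipschitz equivalent. *)
Lemma word_length_bound l' : word_length l' ->
  exists L, forall x, (l' x <= L * l x)%N.
Proof.
move=> wl'; have [/finite_seqP[s As] _ _] := genA.
pose L := \max_(a <- s) l' a; exists L => x.
have [+ _] := lP x; move: (l x) => n.
suff H u : walk A n u x -> (dist l' u x <= L * n)%N.
  by move=> /H; rewrite /dist invg1 mul1g.
elim: n u => [|n IHn] u /=; first by move=> ->; rewrite distxx.
move=> [w uw /IHn wx].
have lw : (dist l' u w <= L)%N.
  have : [set` s] (u^-1 * w) by rewrite -As.
  by move=> /= us; rewrite /L (big_rem _ us) leq_maxl.
by have := dist_tri wl' w u x; rewrite mulnS; lia.
Qed.

End Walks.

(** * Distances and geodesics in the geometric realization *)

Section CayleyMetric.
Import Order.TTheory GRing.Theory Num.Theory.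
Variables (R : realType) (G : groupType) (A : set G).
Hypothesis genA : finite_sym_generating A.
Variable l : G -> nat.
Hypothesis lP : is_word_length A l.
Local Open Scope ring_scope.
Implicit Types (u v w g : G) (x y : G -> R) (s t : R).

Let wl := is_word_lengthP genA lP.
Local Notation d u v := ((dist l u v)%:R : R).

Lemma vertexE u w : vertex R u w = (w == u)%:R.
Proof.
rewrite /vertex indicE; suff -> : (w \in [set u]) = (w == u) by [].
by apply/idP/eqP; rewrite inE.
Qed.

Lemma vertex_edge u v : vertex R u = edge_point u v 0.
Proof. by apply/funext => w; rewrite /edge_point subr0 mul1r mul0r addr0. Qed.

Lemma inf_min (E : set R) r : E r -> lbound E r -> inf E = r.
Proof.
move=> Er Elb; apply/eqP; rewrite eq_le; apply/andP; split.
  by apply: ge_inf => //; exists r.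
by apply: lb_le_inf => //; exists r.
Qed.

Definition routes x y : set R :=
  [set r | exists u v s t,
          [/\ adjacent A u v, x = edge_point u v s, y = edge_point u v t &
              r = `|s - t|]] `|`
  [set r | exists u v n,
          [/\ 0 < x u, 0 < y v, walk A n u v &
              r = (1 - x u) + n%:R + (1 - y v)]].

Lemma routes_sym x y : routes x y `<=` routes y x.
Proof.
move=> r [[u [v [s [t [Auv xE yE ->]]]]]|[u [v [n [xu yv uv ->]]]]].
  by left; exists u, v, t, s; split=> //; rewrite distrC.
right; exists v, u, n; split=> //; first exact: walk_sym.
by rewrite -addrA addrC; congr (_ + _); rewrite addrC.
Qed.

Section Level.
Variable g : G.

(** The distance to [g], extended affinely along an edge. Only vertices and edges leading away from
    [g] are allowed, which suffices for geodesics issuing from [g]. *)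
Definition at_level x s := exists u v (r : R),
  [/\ 0 <= r <= 1, x = edge_point u v r, s = d g u + r &
      r = 0 \/ dist l g v = (dist l g u).+1].

Lemma level_support x s w : at_level x s -> 0 < x w -> `|s - d g w| <= 1 - x w.
Proof.
move=> [u [v [r [r01 -> -> lev]]]]; rewrite /edge_point !vertexE.
have [->|wu] := eqVneq w u; rewrite /= ?mulr1n ?mulr0n.
  have [uv|_] := eqVneq u v; rewrite /= ?mulr1n ?mulr0n.
    by case: lev => [->|]; [rewrite ler_norml; lra | rewrite uv; lia].
  by move=> _; rewrite ler_norml; lra.
have [->|_] := eqVneq w v; rewrite /= ?mulr1n ?mulr0n; last by rewrite ler_norml; lra.
case: lev => [->|->]; first by lra.
by move=> _; rewrite -natr1 ler_norml; lra.
Qed.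

(* Averaging the distance to [g] with respect to the barycentric coordinates
   recovers the level. *)
Lemma level_average x s u v r : at_level x s -> x = edge_point u v r ->
  s = (1 - r) * d g u + r * d g v.
Proof.
move=> [a [b [q [q01 xE -> lev]]]].
pose S := undup [:: a; b; u; v].
pose avg (z : G -> R) := \sum_(w <- S) z w * d g w.
have avgE c e (p : R) : c \in S -> e \in S ->
    avg (edge_point c e p) = (1 - p) * d g c + p * d g e.
  move=> cS eS.
  have sumE k : k \in S -> \sum_(w <- S) (w == k)%:R * d g w = d g k.
    move=> kS; rewrite (bigD1_seq k) ?undup_uniq //= eqxx mul1r big1 ?addr0 //.
    by move=> w /negPf ->; rewrite mul0r.
  rewrite -(sumE c cS) -(sumE e eS) !big_distrr /= -big_split /=.
  by apply: eq_bigr => w _; rewrite /edge_point !vertexE; ring.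
have inS : [&& a \in S, b \in S, u \in S & v \in S].
  by rewrite !mem_undup !inE !eqxx !orbT.
case/and4P: inS => aS bS uS vS; rewrite xE => edgeE.
rewrite -(avgE u v r uS vS) -edgeE avgE //.
by case: lev => [->|->]; rewrite -?natr1; ring.
Qed.

Lemma dist_lip u v w : `|d w u - d w v| <= d u v.
Proof.
have := dist_tri wl u w v; have := dist_tri wl v w u; rewrite (distC wl v u).
by rewrite -!(ler_nat R) !natrD ler_norml; lra.
Qed.

(** The level is 1-Lipschitz along a route: by affinity inside one edge, by the triangle inequality
    on a walk, and by [level_support] on the end pieces. *)
Lemma level_lbound x y s t : at_level x s -> at_level y t ->
  lbound (routes x y) `|s - t|.
Proof.
move=> xs yt r [[u [v [p [q [Auv xE yE ->]]]]]|[u [v [n [xu yv uv ->]]]]].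
  rewrite (level_average xs xE) (level_average yt yE).
  rewrite (_ : _ - _ = (p - q) * (d g v - d g u)); last by ring.
  rewrite normrM ler_piMr // (le_trans (dist_lip _ _ _)) // -[1]/(1%:R) ler_nat.
  by apply: (dist_le_walk lP); apply: walk_sym => //; exists v.
have := level_support xs xu; have := level_support yt yv.
have := dist_lip u v g; have := dist_le_walk lP uv; rewrite -(ler_nat R).
by rewrite !ler_norml; lra.
Qed.

Lemma at_level_vertex u : at_level (vertex R u) (d g u).
Proof.
exists u, u, 0; split; rewrite ?lexx ?ler01 ?addr0 //; last by left.
exact: vertex_edge.
Qed.

End Level.

Lemma cayley_dist_level g x y s t : at_level g x s -> at_level g y t ->
  routes x y `|s - t| -> cayley_dist A x y = `|s - t|.
Proof. by move=> xs yt xy; apply: inf_min => //; apply: level_lbound yt. Qed.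

Lemma cayley_dist_vertex u v : cayley_dist A (vertex R u) (vertex R v) = d u v.
Proof.
have := cayley_dist_level (at_level_vertex u u) (at_level_vertex u v).
rewrite distxx // sub0r normrN normr_nat; apply; right.
exists u, v, (dist l u v); rewrite !vertexE !eqxx subrr add0r addr0 ltr01.
by split=> //; apply: walk_dist.
Qed.

Lemma hyperbolic_four_point :
  gromov_hyperbolic (cayley A) (@cayley_dist R G A) -> exists D, four_point l D.
Proof.
(* Doubling removes the division in Gromov products, and distances between vertices are integers;
   hence an integer above [2 * delta]. *)
move=> [delta delta0 hyp]; exists (Num.truncn (2 * delta)).+1 => x y z w.
have deltaD := truncnS_gt (2 * delta); move: (Num.truncn _).+1 deltaD => D deltaD.
have vert u : cayley A (vertex R u) by left; exists u.
have := hyp _ _ _ _ (vert w) (vert x) (vert y) (vert z).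
rewrite /gromov_product !cayley_dist_vertex leqNgt => gp; apply/negP => gt.
have gt1 : (dist l x y + dist l z w + D < dist l x z + dist l y w)%N by lia.
have gt2 : (dist l x w + dist l y z + D < dist l x z + dist l y w)%N by lia.
rewrite -(ltr_nat R) !natrD in gt1; rewrite -(ltr_nat R) !natrD in gt2.
rewrite (distC wl w x) (distC wl w y) (distC wl w z) in gp.
by move: gp; rewrite lerBlDr ge_min => /orP[]; lra.
Qed.

Section Geodesic.
Variables (v : nat -> G) (n : nat).
Hypothesis vS : forall i, (i < n)%N -> adjacent A (v i) (v i.+1).
Hypothesis v_level : forall i, (i <= n)%N -> dist l (v 0%N) (v i) = i.

(** At the end [t = n] the vertex [v n.+1], beyond the path, has weight 0. *)
Definition path_point (t : R) : G -> R :=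
  let i := Num.truncn t in edge_point (v i) (v i.+1) (t - i%:R).

Lemma path_point_nat i : path_point i%:R = vertex R (v i).
Proof.
by rewrite /path_point natrK subrr -vertex_edge.
Qed.

Lemma truncn_path t : 0 <= t <= n%:R ->
  [/\ (Num.truncn t <= n)%N, (Num.truncn t)%:R <= t < (Num.truncn t).+1%:R &
      Num.truncn t = n -> t = n%:R].
Proof.
move=> /andP[t0 tn]; have t_itv := truncn_itv t0; split=> //.
  by rewrite -(ler_nat R); case/andP: t_itv => le _; apply: le_trans tn.
by move=> tE; apply/eqP; rewrite eq_le tn; case/andP: t_itv; rewrite tE.
Qed.

Lemma at_level_path t : 0 <= t <= n%:R -> at_level (v 0%N) (path_point t) t.
Proof.
move=> tn; have [+ + +] := truncn_path tn; rewrite /path_point.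
set i := Num.truncn t => lein t_itv itn.
exists (v i), (v i.+1), (t - i%:R); split=> //.
- by move: t_itv; rewrite -natr1; lra.
- by rewrite v_level //; lra.
have [lin|] := ltnP i n; first by right; rewrite !v_level.
move=> ni; have iN : i = n by lia.
by left; rewrite (itn iN) iN subrr.
Qed.

Lemma routes_path s t : 0 <= s <= n%:R -> 0 <= t <= n%:R -> s <= t ->
  routes (path_point s) (path_point t) `|s - t|.
Proof.
move=> sn tn st; have [] := truncn_path sn; have [] := truncn_path tn.
set i := Num.truncn s; set j := Num.truncn t => jn t_itv jnt lein s_itv ins.
have ij : (i <= j)%N by apply: le_truncn.
have [ijE|ij'] := eqVneq i j.
  have [lin|ni] := ltnP i n.
    left; exists (v i), (v i.+1), (s - i%:R), (t - i%:R).
    rewrite /path_point -/i -/j -ijE; split=> //; first exact: vS.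
    by congr `|_|; ring.
  have iN : i = n by lia.
  rewrite (ins iN) jnt -?ijE // subrr normr0 path_point_nat; right.
  by exists (v n), (v n), 0%N; rewrite vertexE eqxx /=; split=> //; rewrite ?ltr01 //; ring.
have vne a b : (a <= n)%N -> (b <= n)%N -> a != b -> (v a == v b) = false.
  move=> an bn ab; apply/eqP => vab; case/eqP: ab.
  by rewrite -(v_level an) vab v_level.
have yj : path_point t (v j) = 1 - (t - j%:R).
  rewrite /path_point -/j /edge_point !vertexE eqxx /=.
  have [ljn|nj] := ltnP j n; first by rewrite vne ?(ltnW ljn) //=; [ring | lia].
  have jN : j = n by lia.
  by rewrite (jnt jN) jN subrr mul0r addr0 mulr1.
have yj0 : 0 < 1 - (t - j%:R) by move: t_itv; rewrite -natr1; lra.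
rewrite distrC ger0_norm ?subr_ge0 //; right.
(* A route may leave only through a vertex of positive weight: [v i] when [s] is the integer [i],
   and [v i.+1] otherwise. *)
have [si|si] := leP s i%:R.
  have sE : s = i%:R by apply/eqP; rewrite eq_le si; case/andP: s_itv.
  exists (v i), (v j), (j - i)%N; rewrite yj {1 3}sE path_point_nat vertexE eqxx /=.
  split=> //; first by apply: path_walk vS _; rewrite ij.
  by rewrite natrB // sE; ring.
have xi : path_point s (v i.+1) = s - i%:R.
  rewrite /path_point -/i /edge_point !vertexE eqxx /= vne //=; [ring|lia|lia].
exists (v i.+1), (v j), (j - i.+1)%N; rewrite xi yj; split=> //.
- by lra.
- by apply: path_walk vS _; lia.
by rewrite natrB -?natr1; [ring | lia].
Qed.

Lemma geodesic_path : geodesic (cayley A) (@cayley_dist R G A) n%:R path_point.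
Proof.
split=> [t tn|s t sn tn].
  have [lin t_itv nt] := truncn_path tn.
  have [lt|ge] := ltnP (Num.truncn t) n; last first.
    by left; exists (v n); rewrite (nt _) ?path_point_nat //; lia.
  right; exists (v (Num.truncn t)), (v (Num.truncn t).+1), (t - (Num.truncn t)%:R).
  by split=> //; [exact: vS | move: t_itv; rewrite -natr1; lra].
apply: (cayley_dist_level (at_level_path sn) (at_level_path tn)).
have [st|/ltW ts] := leP s t; first exact: routes_path.
by rewrite distrC; apply/routes_sym/routes_path.
Qed.

End Geodesic.

Lemma eps_quasiconvex_path (eps : R) Q : eps_quasiconvex A eps Q -> exists E : nat,
  forall (v : nat -> G) n,
    (forall i, (i < n)%N -> adjacent A (v i) (v i.+1)) ->
    (forall i, (i <= n)%N -> dist l (v 0%N) (v i) = i) ->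
    Q (v 0%N) -> Q (v n) ->
    forall i, (i <= n)%N -> exists2 q, Q q & (dist l (v i) q <= E)%N.
Proof.
move=> qc; exists (Num.truncn eps) => v n vS v_level Q0 Qn i lein.
have [||||q Qq] := qc _ _ n%:R (path_point v) Q0 Qn _ (geodesic_path vS v_level) _ _ i%:R.
- by rewrite ler0n.
- by rewrite -path_point_nat.
- by rewrite path_point_nat.
- by rewrite ler0n ler_nat.
rewrite path_point_nat cayley_dist_vertex => le; exists q => //.
by rewrite truncn_ge_nat // (le_trans _ le) // ler0n.
Qed.

End CayleyMetric.

(** * Quasiconvexity under change of generating set *)

Section Quasiconvex.
Variables (R : realType) (G : groupType).

(** A geodesic for [A'] is a quasigeodesic for [l], so by [morse] it passes near every point of an
    [l]-geodesic with the same ends; its own points are near [H]. *)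
Lemma quasiconvex_word (l : G -> nat) (A H : set G) delta :
  finite_sym_generating A -> is_word_length A l -> four_point l delta ->
  subgroup H -> quasiconvex R H -> exists D, word_quasiconvex l D H.
Proof.
move=> genA lP hyp sH [A' genA' [eps _ qc]].
have [l' lP'] := is_word_length_ex genA'.
have wl := is_word_lengthP genA lP; have wl' := is_word_lengthP genA' lP'.
have [L lL] := word_length_bound genA' lP' wl.
have [M l'M] := word_length_bound genA lP wl'.
have [E qE] := eps_quasiconvex_path genA' lP' qc.
exists (morse_bound delta L M + L * E)%N => h m Hh mh.
have [wh hmin] := lP' h; have [v [v0 vn vS]] := walk_path wh.
have v_dist i j : (i <= j <= l' h)%N -> dist l' (v i) (v j) = (j - i)%N.
  move=> /andP[ij jn].
  have h1 := dist_le_walk lP' (path_walk vS (i := i) (j := j) ltac:(lia)).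
  have h2 := dist_le_walk lP' (path_walk vS (i := 0%N) (j := i) ltac:(lia)).
  have h3 := dist_le_walk lP' (path_walk vS (i := j) (j := l' h) ltac:(lia)).
  have := dist_tri wl' (v i) (v 0%N) (v (l' h)).
  have := dist_tri wl' (v j) (v i) (v (l' h)).
  have : dist l' (v 0%N) (v (l' h)) = l' h by rewrite v0 vn dist1.
  by lia.
have [t tn mt] : exists2 t, (t <= l' h)%N &
    (dist l m (v t) <= morse_bound delta L M)%N.
  apply: (morse wl hyp).
  - move=> i lin; apply: leq_trans (lL _) _.
    rewrite (_ : l' _ = 1%N) ?muln1 //.
    by rewrite -[LHS]/(dist l' (v i) (v i.+1)) v_dist ?subSnn //; lia.
  - by move=> i j ij; rewrite -v_dist //; apply: l'M.
  - by rewrite /on_geod v0 vn !dist1.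
have [|||q Hq vq] := qE v (l' h) vS _ _ _ t tn.
- by move=> i lein; rewrite v_dist ?subn0.
- by rewrite v0; apply: subgroup1.
- by rewrite vn.
exists q => //; have := dist_tri wl (v t) m q.
have : (dist l (v t) q <= L * E)%N.
  by apply: leq_trans (lL _) _; rewrite leq_mul2l vq orbT.
by lia.
Qed.

End Quasiconvex.

Theorem theorem1 (R : realType) (G : groupType) (s : nat)
    (H : 'I_s -> set G) (K : set G)
    (s_gt0 : (0 < s)%N)
    (hypG : hyperbolic_group R G)
    (subH : forall j, subgroup (H j))
    (qcH : forall j, quasiconvex R (H j))
    (subK : subgroup K) :
  (forall (j : 'I_s) (g : G), infinite_index K (K `&` conj_set (H j) g))
  <->
  (exists2 x : G, K x &
     infinite_order x /\
     generated [set x] `&` \bigcup_j conj_closure (H j) = [set 1%g]).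
Proof.
split=> [infH|[x Kx [x_inf xH]] j g fin]; last first.
  (* Finite index would put a positive power of [x] into a conjugate, hence make it trivial. *)
  have [||n n0 [_ [h Hh xn]]] :=
    @infinite_order_no_finite_index _ K _ x _ fin.
  - by apply: subgroupI => //; apply: subgroup_conj.
  - by move=> n; apply: subgroupX.
  have : [set 1%g] (x ^+ n)%g.
    rewrite -xH; split; first exact: mem_generated1.
    by exists j => //; exists h => //; exists g.
  exact: x_inf.
have [A genA hypA] := hypG.
have [l lP] := is_word_length_ex genA.
have wl := is_word_lengthP genA lP.
have [delta hyp] := hyperbolic_four_point genA lP hypA.
(* Each [H j] may be quasiconvex for its own generating set; all are transferred to the set [A] of
   [hypG], with one common constant. *)
have /choice[D qH] j : exists D, word_quasiconvex l D (H j).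
  exact: quasiconvex_word genA lP hyp (subH j) (qcH j).
have qH' j : word_quasiconvex l (\max_j D j) (H j).
  move=> h m Hh mh; have [q Hq mq] := qH j h m Hh mh.
  by exists q => //; apply: leq_trans mq (leq_bigmax _).
have [x Kx [x_inf xH]] :=
  infinite_index_element wl hyp subK s_gt0 subH qH' infH.
exists x => //; split=> //; rewrite eqEsubset; split=> [y [xy [j _ Hy]]|_ ->].
  have [g Hg] : exists g, conj_set (H j) g y.
    by case: Hy => h Hh [g _ <-]; exists g, h.
  have [[|n] [yx|yx]] := generated1P xy.
  - by rewrite yx expg0.
  - by rewrite yx expg0 invg1.
  - by case: (xH j g n.+1 isT); rewrite -yx.
  - case: (xH j g n.+1 isT); rewrite -[(x ^+ n.+1)%g]invgK -yx.
    exact: subgroupV (subgroup_conj g (subH j)) Hg.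
split; first by rewrite -(expg0 x); apply: mem_generated1.
have sHg := subgroup1 (subgroup_conj 1%g (subH (Ordinal s_gt0))).
by exists (Ordinal s_gt0) => //; case: sHg => h Hh hE; exists h => //; exists 1%g.
Qed.
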